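(* Let $0<r<1$ and $\kappa>0$. Let $(X_i)_{i\ge 1}$ be a sequence of non-negative i.i.d. random variables, copies of a random variable $X$ satisfying $\log \mathbb{P}(X>t)\sim -\kappa t^{r}$ as $t\to\infty$. Let $(a_i(n))_{i\geq 1,\, n=1,2,\ldots}$ be non-negative real numbers with $$\lim_{n\to\infty}\sum_{i=1}^\infty a_i(n)=D\in[0,\infty)$$ and such that $a_{\max}(n):=\max_{i\geq 1}a_i(n)>0$ and $a_{\max}(n)\to 0$ as $n\to\infty$. Then for any $x>D\cdot\mathbb{E}[X]$, $$\lim_{n\to\infty} a_{\max}(n)^r\,\log\mathbb{P}\left(\sum_{i=1}^\infty a_i(n)X_i>x\right)=-\kappa\,(x-D\cdot\mathbb{E}[X])^r.$$
   Context: Here $f(t)\sim g(t)$ as $t\to\infty$ means $f(t)/g(t)\to 1$, and $\log$ is the natural logarithm. The expectation $\mathbb{E}[X]$ is finite because of the tail assumption. *)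

(* Defs.v *)
From HB Require Import structures.
From mathcomp Require Export all_boot all_order all_algebra finmap.
From mathcomp Require Export all_classical all_reals all_analysis.
Export Order.TTheory GRing.Theory Num.Theory.
Export numFieldNormedType.Exports.

Set Implicit Arguments.
Unset Strict Implicit.
Unset Printing Implicit Defensive.

Local Open Scope classical_set_scope.
Local Open Scope ring_scope.

(* Product rule over every finite subfamily of indices. *)
Definition mutually_independent (d : measure_display) (T : measurableType d)
    (R : realType) (P : probability T R) (X : nat -> {RV P >-> R}) : Prop :=
  forall (J : {fset nat}) (B : nat -> set R),
    (forall i, measurable (B i)) ->
    P (\bigcap_(i in [set` J]) (X i @^-1` B i)) =
    (\prod_(i <- J) P (X i @^-1` B i))%E.

(* The laws are compared on measurable sets only: [distribution] is defined on
   all sets, where its values carry no meaning outside the sigma-algebra. *)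
Definition same_law (d : measure_display) (T : measurableType d)
    (R : realType) (P : probability T R) (X Y : {RV P >-> R}) : Prop :=
  forall B : set R, measurable B -> distribution P X B = distribution P Y B.

(* The maximum is attained, in contrast with [sup]. *)
Definition is_maximum (R : realType) (A : set R) (m : R) : Prop :=
  A m /\ ubound A m.

(* Main.v *)
Require Import Defs.
From mathcomp Require Import measurable_realfun ring lra.

(** A single big jump. A stretched exponential tail with exponent [r < 1] is
    heavy: the cheapest way for the weighted sum to exceed [x] is that all
    variables but one behave as usual, and so contribute [D m] with [m] the
    mean, while the variable of largest weight supplies the missing
    [y = x - D m]. The latter costs [kappa (y / alpha) ^ r] on the logarithmic
    scale, where [alpha] is the largest weight.

    Lower bound ([weighted_sum_lower_bound]). The event that the variable of
    largest weight exceeds [(y + eps) / alpha] is independent of the remaining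
    sum, and this sum is at least [D m - eps] with probability at least one half
    by a Laplace transform estimate: the weights have a bounded sum and tend to
    zero uniformly, so the sum of their squares vanishes.

    Upper bound ([weighted_sum_upper_bound]). Let [c < kappa]. Either some term
    exceeds [y], which a union bound controls, or all terms are truncated at
    [y]. In the second case the exponential Markov inequality is used with
    [theta = c y ^ (r - 1) / alpha ^ r]. By concavity of [t |-> t ^ r], on the
    truncation event [theta a X <= c X ^ r] for every weight [a <= alpha], so
    the second order term of the moment generating function of [theta a X] is
    controlled by the expectation of [X ^ 2 exp (c X ^ r)]. That is finite since
    [c < kappa], and the product of the generating functions is at most
    [exp (theta (D m + o(1)))], which leaves [exp (- theta (y - o(1)))], whose
    exponent is asymptotically [- c y ^ r / alpha ^ r].

    Both bounds concern finite sums, uniformly in the number of terms; a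
    continuity argument carries them over to the series, and letting [c] tend
    to [kappa] and [eps] to [0] identifies the limit. *)

Local Open Scope classical_set_scope.
Local Open Scope ring_scope.
Import HBNNSimple.
Set Implicit Arguments.
Unset Strict Implicit.
Unset Printing Implicit Defensive.

(** * Laws and independence *)

Section independence.
Local Open Scope ereal_scope.
Context d (T : measurableType d) (R : realType) (P : probability T R).

Lemma integral_simple_comp (Y : {RV P >-> R}) (G : T -> R)
    (f : {nnsfun R >-> R}) :
  measurable_fun setT G -> (forall w, (0 <= G w)%R) ->
  \int[P]_w (G w * f (Y w))%:E =
  (\sum_(y \in range f)
     y%:E * \int[P]_w (G w * \1_(f @^-1` [set y]) (Y w))%:E)%E.
Proof.
move=> mG G0.
have mI y : measurable_fun setT (fun w => \1_(f @^-1` [set y]) (Y w) : R)%R.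
  by apply: measurableT_comp => //.
have f0 y w : (0 <= G w * (y * \1_(f @^-1` [set y]) (Y w)))%R.
  apply: mulr_ge0 => //.
  have := nnfun_muleindic_ge0 f y (Y w).
  by rewrite lee_fin.
transitivity (\int[P]_w (\sum_(y \in range f)
    (G w * (y * \1_(f @^-1` [set y]) (Y w)))%:E)%E).
  apply: eq_integral => w _.
  rewrite fsumEFin// [in LHS](fimfunE f).
  by rewrite mulr_fsumr.
rewrite ge0_integral_fsum//; last 2 first.
- move=> y; apply/measurable_EFinP; apply: measurable_funM => //.
  exact: measurable_funM.
- by move=> y w _; rewrite lee_fin.
apply: eq_fsbigr => y; rewrite inE => -[v _ fv].
have y0 : (0 <= y)%R by rewrite -fv.
rewrite -ge0_integralZl//.
- by apply: eq_integral => w _; rewrite -EFinM mulrCA.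
- by apply/measurable_EFinP; exact: measurable_funM.
- by move=> w _; rewrite lee_fin mulr_ge0.
Qed.

Lemma integral_comp_lim (Y : {RV P >-> R}) (G : T -> R) (f : R -> R)
    (mf : measurable_fun setT (EFin \o f)) :
  measurable_fun setT G -> (forall w, (0 <= G w)%R) ->
  (forall y, (0 <= f y)%R) ->
  (fun n => \int[P]_w (G w * nnsfun_approx measurableT mf n (Y w))%:E)
    @ \oo --> \int[P]_w (G w * f (Y w))%:E.
Proof.
move=> mG G0 f0.
set h := nnsfun_approx measurableT mf.
have -> : \int[P]_w (G w * f (Y w))%:E =
          \int[P]_w limn (fun n => (G w * h n (Y w))%:E).
  apply: eq_integral => w _; apply/esym/cvg_lim => //.
  under eq_fun do rewrite EFinM.
  rewrite EFinM; apply: cvgeZl => //.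
  apply: (@cvg_nnsfun_approx _ _ _ _ measurableT _ mf) => // x _.
  by rewrite lee_fin.
apply: cvg_monotone_convergence => //.
- move=> n; apply/measurable_EFinP; apply: measurable_funM => //.
  exact: measurableT_comp.
- by move=> n w _; rewrite lee_fin mulr_ge0.
- move=> w _ m n mn; rewrite lee_fin ler_wpM2l//.
  exact/lefP/nd_nnsfun_approx.
Qed.

(** Two densities that give [Y] the same law give the same integral to every
    non-negative function of [Y]. This is how a product formula known for
    indicator functions passes to general functions, one factor at a time. *)
Lemma eq_integral_comp (Y : {RV P >-> R}) (G1 G2 : T -> R) (f : R -> R) :
  measurable_fun setT G1 -> (forall w, (0 <= G1 w)%R) ->
  measurable_fun setT G2 -> (forall w, (0 <= G2 w)%R) ->
  measurable_fun setT f -> (forall y, (0 <= f y)%R) ->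
  (forall B, measurable B -> \int[P]_w (G1 w * \1_B (Y w))%:E =
                             \int[P]_w (G2 w * \1_B (Y w))%:E) ->
  \int[P]_w (G1 w * f (Y w))%:E = \int[P]_w (G2 w * f (Y w))%:E.
Proof.
move=> mG1 G10 mG2 G20 mf f0 H.
have mf' : measurable_fun setT (EFin \o f) by exact/measurable_EFinP.
have C1 := integral_comp_lim (Y := Y) mf' mG1 G10 f0.
have C2 := integral_comp_lim (Y := Y) mf' mG2 G20 f0.
apply: (cvg_unique _ C1) => //.
have -> : (fun n =>
      \int[P]_w (G1 w * nnsfun_approx measurableT mf' n (Y w))%:E) =
    (fun n =>
      \int[P]_w (G2 w * nnsfun_approx measurableT mf' n (Y w))%:E).
  apply/funext => n; rewrite !integral_simple_comp//.
  apply: eq_fsbigr => y _; congr (_ * _)%E.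
  by apply: H.
exact: C2.
Qed.

Lemma same_law_integral (Y Z : {RV P >-> R}) (f : R -> \bar R) :
  same_law Y Z -> measurable_fun setT f -> (forall y, (0 <= f y)%E) ->
  \int[P]_w f (Y w) = \int[P]_w f (Z w).
Proof.
move=> YZ mf f0.
rewrite -[LHS]/(\int[P]_w (f \o Y) w) -[RHS]/(\int[P]_w (f \o Z) w).
rewrite -!ge0_integral_distribution//.
by apply: eq_measure_integral => A mA _; exact: YZ.
Qed.

(** The positive parts of [Y] and [Z] have equal integrals, and so have the
    negative parts. *)
Lemma same_law_expectation (Y Z : {RV P >-> R}) :
  same_law Y Z -> 'E_P[Y] = 'E_P[Z].
Proof.
move=> YZ; rewrite !expectation_def integralE [RHS]integralE.
have mE : measurable_fun setT (EFin : R -> \bar R) by exact/measurable_EFinP.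
congr (_ - _).
  transitivity (\int[P]_w (EFin : R -> \bar R)^\+ (Y w)).
    by apply: eq_integral => w _; rewrite !funeposE.
  rewrite (same_law_integral YZ); last by move=> y; exact: funepos_ge0.
    by apply: eq_integral => w _; rewrite !funeposE.
  exact: measurable_funepos.
transitivity (\int[P]_w (EFin : R -> \bar R)^\- (Y w)).
  by apply: eq_integral => w _; rewrite !funenegE.
rewrite (same_law_integral YZ); last by move=> y; exact: funeneg_ge0.
  by apply: eq_integral => w _; rewrite !funenegE.
exact: measurable_funeneg.
Qed.

Lemma same_law_gt (Y Z : {RV P >-> R}) (t : R) : same_law Y Z ->
  P [set w | (t < Y w)%R] = P [set w | (t < Z w)%R].
Proof.
have E (V : {RV P >-> R}) : [set w | (t < V w)%R] = V @^-1` `]t, +oo[%classic.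
  by apply/seteqP; split => w /=; rewrite in_itv/= andbT.
by move=> YZ; rewrite !E; exact: YZ.
Qed.

(** By induction on the number [k] of leading factors that are not indicator
    functions. The case [k = 0] is the product rule for events, and
    [eq_integral_comp] frees the factor of index [k] while the others form the
    density. *)
Lemma integral_prod_indep (Xs : nat -> {RV P >-> R}) (g : nat -> R -> R)
    (c : nat -> R) :
  mutually_independent Xs ->
  (forall i, measurable_fun setT (g i)) -> (forall i y, (0 <= g i y)%R) ->
  (forall i, \int[P]_w (g i (Xs i w))%:E = (c i)%:E) ->
  forall N, \int[P]_w (\prod_(i < N) g i (Xs i w))%:E = (\prod_(i < N) c i)%:E.
Proof.
move=> ind mg g0 gc N.
suff: forall k (g : nat -> R -> R) c,
  (forall i, measurable_fun setT (g i)) -> (forall i y, (0 <= g i y)%R) ->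
  (forall i, \int[P]_w (g i (Xs i w))%:E = (c i)%:E) ->
  (forall i, (k <= i < N)%N -> exists2 B, measurable B & g i = \1_B) ->
  \int[P]_w (\prod_(i < N) g i (Xs i w))%:E = (\prod_(i < N) c i)%:E.
  move=> /(_ N); apply => // i /andP[Ni iN].
  by have := leq_ltn_trans Ni iN; rewrite ltnn.
move=> {g c mg g0 gc}; elim=> [|k IH] g c mg g0 gc ind_g.
  have /choice[B HB] : forall i, exists B,
      measurable B /\ ((i < N)%N -> g i = \1_B).
    move=> i; have [iN|iN] := boolP (i < N)%N.
      by have [B mB ->] := ind_g i iN; exists B.
    by exists setT; split.
  pose J := [fset i in iota 0 N]%fset.
  have JE (F : nat -> \bar R) : (\prod_(i <- J) F i = \prod_(i < N) F i)%E.
    rewrite -(big_mkord xpredT) /index_iota subn0.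
    apply: perm_big; apply: uniq_perm; rewrite ?fset_uniq ?iota_uniq//.
    by move=> i; rewrite !inE.
  have mB i : measurable (B i) by have [] := HB i.
  transitivity (\int[P]_w (\1_(\bigcap_(i in [set` J]) (Xs i @^-1` B i)) w)%:E).
    apply: eq_integral => w _; congr EFin.
    rewrite indicE; have [wJ|wJ] := boolP (w \in _).
      rewrite big1// => i _; have [_ -> //] := HB i.
      rewrite indicE (_ : _ \in _)//; apply/mem_set.
      by move/set_mem: wJ => /(_ i); apply; rewrite /= !inE mem_iota/=.
    have : ~ (forall i, (i < N)%N -> B i (Xs i w)).
      move=> h; move/negP: wJ; apply; apply/mem_set => i /=.
      by rewrite !inE mem_iota /= => iN; exact: h.
    move=> /existsNP[i /not_implyP[iN Bi]].
    rewrite (bigD1 (Ordinal iN))//=; have [_ -> //] := HB i.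
    by rewrite indicE memNset// mul0r.
  rewrite integral_indic//; last first.
    apply: fin_bigcap_measurable => // i _.
    by rewrite -[X in measurable X]setTI; exact: measurable_funPT.
  rewrite setIT [LHS](ind J B mB) JE.
  rewrite -prodEFin; apply: eq_bigr => i _; rewrite -gc.
  have [_ -> //] := HB i.
  rewrite -[RHS]/(\int[P]_w (\1_(Xs i @^-1` B i) w)%:E).
  rewrite integral_indic// ?setIT//.
  by rewrite -[X in measurable X]setTI; exact: measurable_funPT.
have [kN|Nk] := ltnP k N; last first.
  apply: (IH g c mg g0 gc) => i /andP[ki iN].
  by have := leq_ltn_trans (leq_trans Nk ki) iN; rewrite ltnn.
pose K := Ordinal kN.
pose G w := (\prod_(i < N | i != K) g i (Xs i w))%R.
have mgX i : measurable_fun setT (fun w => g i (Xs i w)).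
  exact: measurableT_comp.
have mG : measurable_fun setT G.
  rewrite /G; under eq_fun do rewrite big_mkcond.
  by apply: measurable_prod => i _; case: (i != K).
have G0 w : (0 <= G w)%R by apply: prodr_ge0.
pose C := (\prod_(i < N | i != K) c i)%R.
have c0 i : (0 <= c i)%R.
  by rewrite -lee_fin -gc; apply: integral_ge0 => w _; rewrite lee_fin.
have C0 : (0 <= C)%R by apply: prodr_ge0.
transitivity (\int[P]_w (G w * g k (Xs k w))%:E).
  by apply: eq_integral => w _; rewrite (bigD1 K)//= mulrC.
rewrite (@eq_integral_comp (Xs k) G (cst C) (g k))//.
- under eq_integral do rewrite EFinM [cst C _]/=.
  rewrite ge0_integralZl//; last 2 first.
  + exact/measurable_EFinP.
  + by move=> w _; rewrite lee_fin.
  by rewrite gc -EFinM (bigD1 K)//= mulrC.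
- move=> B mB.
  have mXB : measurable (Xs k @^-1` B).
    by rewrite -[X in measurable X]setTI; exact: measurable_funPT.
  have PE : \int[P]_w (\1_B (Xs k w))%:E = (fine (P (Xs k @^-1` B)))%:E.
    rewrite -[LHS]/(\int[P]_w (\1_(Xs k @^-1` B) w)%:E).
    by rewrite integral_indic// setIT fineK// fin_num_measure.
  have m1 : measurable_fun setT (\1_B : R -> R) by exact: measurable_indic.
  pose g' i := if i == k then \1_B else g i.
  pose c' i := if i == k then fine (P (Xs k @^-1` B)) else c i.
  have gE w : (\prod_(i < N) g' i (Xs i w) = G w * \1_B (Xs k w))%R.
    rewrite (bigD1 K)//= /g' eqxx mulrC; congr (_ * _)%R.
    by apply: eq_bigr => i iK; rewrite ifN.
  have cE : (\prod_(i < N) c' i = C * fine (P (Xs k @^-1` B)))%R.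
    rewrite (bigD1 K)//= /c' eqxx mulrC; congr (_ * _)%R.
    by apply: eq_bigr => i iK; rewrite ifN.
  transitivity (\prod_(i < N) c' i)%:E.
    under eq_integral do rewrite -gE.
    apply: IH.
    + by move=> i; rewrite /g'; case: ifP.
    + by move=> i y; rewrite /g'; case: ifP => // _; rewrite indicE ler0n.
    + by move=> i; rewrite /g' /c'; case: ifPn => // /eqP ->.
    + move=> i /andP[ki iN]; rewrite /g'; have [_|ik] := eqVneq i k.
        by exists B.
      by apply: ind_g; rewrite iN andbT ltn_neqAle eq_sym ik.
  rewrite cE EFinM -PE -ge0_integralZl//.
  exact/measurable_EFinP/measurableT_comp.
Qed.
Lemma integral_prod_indep_le (Xs : nat -> {RV P >-> R}) (g : nat -> R -> R)
    (b : nat -> R) N :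
  mutually_independent Xs ->
  (forall i, measurable_fun setT (g i)) -> (forall i y, (0 <= g i y)%R) ->
  (forall i, \int[P]_w (g i (Xs i w))%:E <= (b i)%:E) ->
  \int[P]_w (\prod_(i < N) g i (Xs i w))%:E <= (\prod_(i < N) b i)%:E.
Proof.
move=> ind mg g0 gb.
have I0 i : 0 <= \int[P]_w (g i (Xs i w))%:E.
  by apply: integral_ge0 => w _; rewrite lee_fin.
have fI i : \int[P]_w (g i (Xs i w))%:E \is a fin_num.
  by rewrite ge0_fin_numE//; apply: le_lt_trans (gb i) _; exact: ltry.
rewrite (@integral_prod_indep Xs g
  (fun i => fine (\int[P]_w (g i (Xs i w))%:E)))//; last first.
  by move=> i; rewrite fineK.
rewrite lee_fin; apply: ler_prod => i _; rewrite fine_ge0//=.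
by rewrite -lee_fin fineK.
Qed.

End independence.

(** * Elementary inequalities *)

Section real_inequalities.
Context {R : realType}.
Implicit Types t u c r : R.

Lemma expR_sub1_le u : expR u - 1 <= u * expR u.
Proof.
have := expR_ge1Dx (- u); rewrite expRN => h.
have e0 := expR_gt0 u.
have : (1 + - u) * expR u <= (expR u)^-1 * expR u by rewrite ler_wpM2r// ltW.
by rewrite mulVf ?gt_eqF//; nra.
Qed.

Lemma expR_le_quadratic u : 0 <= u -> expR u <= 1 + u + u ^+ 2 * expR u.
Proof. by move=> u0; have := expR_sub1_le u; nra. Qed.

Lemma expRN_le_quadratic u : 0 <= u -> expR (- u) <= 1 - u + u ^+ 2.
Proof.
by move=> u0; have := expR_sub1_le (- u); have := expR_ge1Dx (- u); nra.
Qed.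

(** With [a = eta r / 2], the bound [a t ^ r <= exp (a t ^ r)] raised to the
    power [2 / r] bounds [t ^ 2] by a multiple of [exp (eta t ^ r)]. *)
Lemma quadratic_le_stretched_exp r eta : 0 < r -> 0 < eta ->
  exists2 K : R, 0 < K &
    forall t, 0 <= t -> 1 + t + t ^+ 2 <= K * expR (eta * t `^ r).
Proof.
move=> r0 eta0.
pose a := eta * r / 2.
have a0 : 0 < a by rewrite /a; apply: divr_gt0 => //; exact: mulr_gt0.
have k0 : 0 < a `^ (2 / r) by exact: powR_gt0.
exists (2 + 2 / a `^ (2 / r)).
  by apply: addr_gt0 => //; exact: divr_gt0.
move=> t t0.
have e1 : 1 <= expR (eta * t `^ r).
  by apply: le_trans (expR_ge1Dx _); rewrite lerDl mulr_ge0 ?powR_ge0// ltW.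
have : t ^+ 2 * a `^ (2 / r) <= expR (eta * t `^ r).
  have -> : expR (eta * t `^ r) = (expR (a * t `^ r)) `^ (2 / r).
    rewrite -expRM; congr expR; rewrite /a.
    have : r != 0 by rewrite gt_eqF.
    by move=> ?; field.
  have -> : t ^+ 2 * a `^ (2 / r) = (a * t `^ r) `^ (2 / r).
    rewrite (powRM _ (ltW a0) (powR_ge0 _ _)) -(powRrM t) mulrC; congr (_ * _).
    have -> : r * (2 / r) = 2%:R by field; rewrite gt_eqF.
    by rewrite powR_mulrn.
  apply: ge0_ler_powR; rewrite ?nnegrE ?expR_ge0//.
  - by rewrite divr_ge0// ltW.
  - by rewrite mulr_ge0 ?powR_ge0// ltW.
  - by have := expR_ge1Dx (a * t `^ r); lra.
rewrite -ler_pdivlMr// => h.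
rewrite mulrDl; apply: (@le_trans _ _ (2 + 2 * t ^+ 2)); first by nra.
apply: lerD; first by rewrite ler_peMr.
by rewrite -mulrA ler_wpM2l// mulrC.
Qed.

(** The point where [r < 1] enters: since [r - 1 < 0], replacing [y] by the
    smaller number [a t] increases [y ^ (r - 1)], and then the powers of [a] and
    of [alpha] compare. *)
Lemma truncated_exponent_le c r alpha y a t :
  0 <= c -> 0 < r -> r < 1 -> 0 < alpha -> 0 < y -> 0 <= a <= alpha -> 0 <= t ->
  a * t <= y -> c * (y `^ (r - 1) / alpha `^ r) * a * t <= c * t `^ r.
Proof.
move=> c0 r0 r1 al0 y0 /andP[a0 aal] t0 aty.
have -> : c * (y `^ (r - 1) / alpha `^ r) * a * t =
    c * (y `^ (r - 1) * (a * t) / alpha `^ r) by rewrite !mulrA; ring.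
rewrite ler_wpM2l// ler_pdivrMr ?powR_gt0//.
apply: (@le_trans _ _ ((a * t) `^ r)); last first.
  rewrite (powRM _ a0 t0) mulrC ler_wpM2l ?powR_ge0//.
  by apply: ge0_ler_powR; rewrite ?nnegrE ?(ltW r0) ?(ltW al0).
have [->|atN0] := eqVneq (a * t) 0; first by rewrite mulr0 powR_ge0.
have at0 : 0 < a * t by rewrite lt_neqAle eq_sym atN0 mulr_ge0.
rewrite -[leRHS]mulr_powRB1// ?(ltW at0)// mulrC ler_wpM2l ?(ltW at0)//.
rewrite -[r - 1]opprB !powRN lef_pV2 ?posrE ?powR_gt0//.
apply: ge0_ler_powR => //; rewrite ?nnegrE ?(ltW at0) ?(ltW y0)//.
by rewrite subr_ge0 ltW.
Qed.

Lemma powR_div u v r : 0 <= u -> 0 < v ->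
  (u / v) `^ r = u `^ r / v `^ r.
Proof.
move=> u0 v0; rewrite -[in RHS](divfK (lt0r_neq0 v0) u).
by rewrite [in RHS]powRM ?divr_ge0 ?(ltW v0)// mulfK// gt_eqF// powR_gt0.
Qed.

End real_inequalities.

(** * Moments under a stretched exponential tail *)

Section tail.
Context {R : realType}.

Lemma log_tail_bounds (p : R -> \bar R) (kappa r delta : R) :
  0 < kappa -> 0 < delta ->
  (forall t, (0 <= p t)%E) ->
  (lne (p t) / (- (kappa * t `^ r))%:E)%E @[t --> +oo] --> 1%E ->
  \forall t \near +oo,
    ((expR (- (kappa * (1 + delta) * t `^ r)))%:E <= p t
      <= (expR (- (kappa * (1 - delta) * t `^ r)))%:E)%E.
Proof.
move=> kappa0 delta0 p0 /fine_cvgP[fin cvg1].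
have /cvgrPdist_lt/(_ _ delta0) near1 := cvg1.
near=> t.
have t0 : 0 < t by near: t; exact: nbhs_pinfty_gt.
have q0 : 0 < kappa * t `^ r by rewrite mulr_gt0// powR_gt0.
have fint : (lne (p t) / (- (kappa * t `^ r))%:E)%E \is a fin_num by near: t.
have : `|1 - fine (lne (p t) / (- (kappa * t `^ r))%:E)%E| < delta by near: t.
have qi : (- (kappa * t `^ r))^-1 < 0 by rewrite invr_lt0 oppr_lt0.
move: fint; rewrite inver oppr_eq0 gt_eqF//.
(* A zero probability has logarithm [-oo], so its ratio is [+oo]. *)
case: (p t) (p0 t) => [s| |]//; last first.
  by rewrite lt0_mulye.
rewrite lee_fin le_eqVlt => /predU1P[<-|s0].
  by rewrite le0_lneNy// lt0_mulNye.
rewrite lne_EFin// => _ /=.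
rewrite invrN mulrN opprK ltr_norml => /andP[h1 h2].
have e : ln s / (kappa * t `^ r) * (kappa * t `^ r) = ln s.
  by rewrite -mulrA mulVf ?mulr1// gt_eqF.
rewrite !lee_fin -[s]lnK ?posrE// !ler_expR -e.
by apply/andP; split; nra.
Unshelve. all: by end_near. Qed.

End tail.

Section moments.
Context d (T : measurableType d) (R : realType) (P : probability T R).
Local Open Scope ereal_scope.

(** Splitting according to the integer interval that contains [Z] gives
    [exp (c Z) <= exp (c (K + 1)) + \sum_(k >= K) exp (c (k + 2)) 1_(Z > k)]
    and, beyond [K], the expectations of the terms decay geometrically. *)
Lemma exp_moment_lty (Z : T -> R) (c c1 : R) :
  measurable_fun setT Z -> (0 < c)%R -> (c < c1)%R ->
  (\forall z \near +oo%R, P [set w | (z < Z w)%R] <= (expR (- (c1 * z)))%:E) ->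
  \int[P]_w (expR (c * Z w))%:E < +oo.
Proof.
move=> mZ c0 cc1 tailZ.
have [K HK] : exists K : nat, forall k : nat, (K <= k)%N ->
    P [set w | (k%:R < Z w)%R] <= (expR (- (c1 * k%:R)))%:E.
  have [M [Mr HM]] := tailZ.
  exists (Num.trunc `|M|).+1 => k Kk; apply: HM.
  apply: (le_lt_trans (ler_norm M)).
  have /andP[_ h] := trunc_itv (normr_ge0 M).
  by apply: lt_le_trans h _; rewrite ler_nat.
pose A k := [set w | ((k + K)%N%:R < Z w)%R].
have mA k : measurable (A k).
  have -> : A k = setT `&` Z @^-1` `](k + K)%:R, +oo[%classic.
    by rewrite setTI; apply/seteqP; split => w /=; rewrite in_itv/= andbT.
  exact: mZ.
pose b k := expR (c * (k + K).+2%:R).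
have mexp : measurable_fun setT (fun w => expR (c * Z w)).
  apply: measurableT_comp => //; exact: measurable_funM.
have mI k : measurable_fun setT (fun w => (b k * \1_(A k) w)%:E).
  by apply/measurable_EFinP; apply: measurable_funM.
apply: (@le_lt_trans _ _ (\int[P]_w ((expR (c * K.+1%:R))%:E +
   \sum_(k <oo) (b k * \1_(A k) w)%:E))).
  apply: ge0_le_integral => //.
  - exact/measurable_EFinP.
  - apply: emeasurable_funD => //.
    apply: (ge0_emeasurable_sum (P := xpredT)) => //.
    by move=> k w _ _; rewrite lee_fin mulr_ge0 ?expR_ge0// indicE ler0n.
  - move=> w _.
    have ge0 k : 0 <= (b k * \1_(A k) w)%:E.
      by rewrite lee_fin mulr_ge0 ?expR_ge0// indicE ler0n.
    have [zK|zK] := leP (Z w) K.+1%:R.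
      rewrite -[leLHS]adde0 leeD//.
        by rewrite lee_fin ler_expR ler_pM2l.
      exact: nneseries_ge0.
    have z0 : (0 <= Z w)%R by apply: le_trans (ltW zK).
    have /andP[lz zl] := trunc_itv z0.
    pose k := ((Num.trunc (Z w)).-1 - K)%N.
    have Kz : (K.+1 <= Num.trunc (Z w))%N.
      by rewrite -ltnS -(ltr_nat R) (lt_trans zK).
    have kE : ((k + K).+1 = Num.trunc (Z w))%N.
      rewrite /k; case: Num.trunc Kz => // n; rewrite ltnS /= => ?.
      by rewrite subnK.
    apply: (@le_trans _ _ (b k * \1_(A k) w)%:E).
      rewrite indicE mem_set ?mulr1.
        by rewrite lee_fin ler_expR ler_pM2l// ltW// kE.
      by rewrite /A /=; apply: lt_le_trans lz; rewrite ltr_nat -kE.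
    rewrite -[leLHS]add0e leeD ?lee_fin ?expR_ge0//.
    rewrite (@nneseriesD1 _ _ k)//.
    rewrite leeDl//; apply: nneseries_ge0 => *; exact: ge0.
rewrite ge0_integralD//; last 2 first.
- move=> w _; apply: nneseries_ge0 => k _ _.
  by rewrite lee_fin mulr_ge0 ?expR_ge0// indicE ler0n.
- apply: (ge0_emeasurable_sum (P := xpredT)) => //.
  by move=> k w _ _; rewrite lee_fin mulr_ge0 ?expR_ge0// indicE ler0n.
rewrite integral_cst// [X in _ * X + _]probability_setT mule1.
rewrite integral_nneseries//; last first.
  by move=> k w _; rewrite lee_fin mulr_ge0 ?expR_ge0// indicE ler0n.
apply: lte_add_pinfty; first exact: ltry.
pose q := expR (c - c1).
pose a := expR (c * K.+2%:R - c1 * K%:R).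
apply: (@le_lt_trans _ _ (a / (1 - q))%:E); last exact: ltry.
have q0 : (0 < q)%R by exact: expR_gt0.
have q1 : (`|q| < 1)%R by rewrite gtr0_norm// /q expR_lt1 subr_lt0.
apply: lime_le.
  apply: is_cvg_nneseries => k _ _; apply: integral_ge0 => w _.
  by rewrite lee_fin mulr_ge0 ?expR_ge0// indicE ler0n.
apply: nearW => n.
apply: (@le_trans _ _ (series (geometric a q) n)%:E); last first.
  by rewrite lee_fin; apply: geometric_le_lim => //; exact: expR_ge0.
rewrite /series /= -sumEFin; apply: lee_sum => k _.
under eq_integral do rewrite EFinM.
rewrite ge0_integralZl//; last 2 first.
- exact/measurable_EFinP.
- by rewrite lee_fin expR_ge0.
rewrite integral_indic// setIT.
apply: (@le_trans _ _ ((b k)%:E * (expR (- (c1 * (k + K)%:R)))%:E)).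
  by rewrite lee_pmul2l ?lte_fin ?expR_gt0// HK// leq_addl.
rewrite -EFinM lee_fin /b /a /q -expRM_natl -!expRD ler_expR.
by rewrite -!natr1 !natrD; lra.
Qed.

End moments.

(** The factor [1 + t + t ^ 2] makes one finite expectation serve for the mean,
    for the union bound (where [t] is needed) and for the second order terms
    of the generating functions (where [t ^ 2] is needed). *)
Definition stretched_weight (R : realType) (r c t : R) : R :=
  (1 + t + t ^+ 2) * expR (c * t `^ r).

Section stretched_weight.
Context {R : realType}.
Implicit Types t r c : R.

Lemma measurable_stretched_weight r c :
  measurable_fun setT (stretched_weight r c : R -> R).
Proof.
apply: measurable_funM.
  apply: measurable_funD; last exact: measurable_funX.
  exact: measurable_funD.
by apply: measurableT_comp => //; exact: measurable_funM.
Qed.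

Lemma stretched_weight_ge0 r c t : 0 <= t -> 0 <= stretched_weight r c t.
Proof. by move=> t0; rewrite mulr_ge0 ?expR_ge0// !addr_ge0// sqr_ge0. Qed.

Lemma sqr_expR_le_stretched_weight r c t : 0 <= t ->
  t ^+ 2 * expR (c * t `^ r) <= stretched_weight r c t.
Proof. by move=> t0; rewrite ler_wpM2r ?expR_ge0// lerDr addr_ge0. Qed.

Lemma quadratic_le_stretched_weight r c t : 0 <= c -> 0 <= t ->
  1 + t + t ^+ 2 <= stretched_weight r c t.
Proof.
move=> c0 t0; rewrite ler_peMr ?addr_ge0 ?sqr_ge0//.
by apply: le_trans (expR_ge1Dx _); rewrite lerDl mulr_ge0 ?powR_ge0.
Qed.

End stretched_weight.

Section stretched_moment.
Context d (T : measurableType d) (R : realType) (P : probability T R).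
Local Open Scope ereal_scope.

(** For [c < c2 < c1] the quadratic factor is absorbed by
    [exp ((c2 - c) Y ^ r)], and [Y ^ r] has an exponential tail of rate
    [c1]. *)
Lemma stretched_moment_bounded (Y : {RV P >-> R}) (r c c1 : R) :
  (forall w, (0 <= Y w)%R) -> (0 < r)%R -> (0 < c)%R -> (c < c1)%R ->
  (\forall t \near +oo%R,
     P [set w | (t < Y w)%R] <= (expR (- (c1 * t `^ r)))%:E) ->
  exists M : R,
    \int[P]_w (stretched_weight r c (Y w))%:E <= M%:E.
Proof.
move=> Y0 r0 c0 cc1 [M [_ HM]].
pose c2 := ((c + c1) / 2)%R.
have cc2 : (c < c2)%R by rewrite /c2; lra.
have c2c1 : (c2 < c1)%R by rewrite /c2; lra.
have c20 : (0 < c2)%R by exact: lt_trans cc2.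
have mYr : measurable_fun setT (fun w => Y w `^ r)%R.
  exact: (measurableT_comp (measurable_powR r)).
have fin : \int[P]_w (expR (c2 * Y w `^ r))%:E < +oo.
  apply: (exp_moment_lty mYr c20 c2c1).
  exists (`|M| `^ r)%R; split => // z Mz.
  have z0 : (0 < z)%R by apply: le_lt_trans Mz; exact: powR_ge0.
  have zE : ((z `^ r^-1) `^ r = z)%R.
    by rewrite -powRrM mulVf ?gt_eqF// powRr1// ltW.
  have -> : [set w | (z < Y w `^ r)%R] = [set w | (z `^ r^-1 < Y w)%R].
    apply/seteqP; split => w /=; rewrite !ltNge; apply: contra => h.
      rewrite -zE; apply: ge0_ler_powR; rewrite ?nnegrE ?powR_ge0//.
      exact: ltW.
    have -> : Y w = ((Y w `^ r) `^ r^-1)%R.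
      by rewrite -powRrM mulfV ?gt_eqF// powRr1.
    apply: ge0_ler_powR; rewrite ?nnegrE ?powR_ge0 ?(ltW z0)//.
    by rewrite invr_ge0 ltW.
  rewrite -[in leRHS]zE; apply: HM; apply: le_lt_trans (ler_norm M) _.
  have -> : (`|M| = (`|M| `^ r) `^ r^-1)%R.
    by rewrite -powRrM mulfV ?gt_eqF// powRr1.
  by apply: gt0_ltr_powR; rewrite ?nnegrE ?powR_ge0 ?(ltW z0) ?invr_gt0.
have c2c : (0 < c2 - c)%R by rewrite subr_gt0.
have [K K0 HK] := quadratic_le_stretched_exp r0 c2c.
pose I := \int[P]_w (expR (c2 * Y w `^ r))%:E.
have I0 : 0 <= I by apply: integral_ge0 => w _; rewrite lee_fin expR_ge0.
exists (K * fine I)%R.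
rewrite EFinM fineK; last by rewrite ge0_fin_numE.
rewrite /I -ge0_integralZl//.
- apply: ge0_le_integral => //.
  + by move=> w _; rewrite lee_fin stretched_weight_ge0.
  + apply/measurable_EFinP.
    exact: (measurableT_comp (measurable_stretched_weight r c)).
  + apply: emeasurable_funM => //; apply/measurable_EFinP.
    by apply: measurableT_comp => //; exact: measurable_funM.
  + move=> w _; rewrite -EFinM lee_fin.
    have -> : (c2 * Y w `^ r = (c2 - c) * Y w `^ r + c * Y w `^ r)%R by ring.
    by rewrite /stretched_weight expRD mulrA ler_wpM2r ?expR_ge0// HK.
- by apply/measurable_EFinP; apply: measurableT_comp => //; exact: measurable_funM.
- by rewrite lee_fin ltW.
Qed.

Lemma stretched_moment_expectation_fin_num (Y : {RV P >-> R}) (r c M : R) :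
  (forall w, (0 <= Y w)%R) -> (0 < c)%R ->
  \int[P]_w (stretched_weight r c (Y w))%:E <= M%:E ->
  'E_P[Y] \is a fin_num.
Proof.
move=> Y0 c0 YM; rewrite expectation_def ge0_fin_numE; last first.
  by apply: integral_ge0 => w _; rewrite lee_fin.
apply: le_lt_trans (ltry M); apply: le_trans YM.
apply: ge0_le_integral => //.
- by move=> w _; rewrite lee_fin.
- exact/measurable_EFinP.
- apply/measurable_EFinP.
  exact: (measurableT_comp (measurable_stretched_weight r c)).
- move=> w _; rewrite lee_fin.
  apply: le_trans (quadratic_le_stretched_weight r (ltW c0) (Y0 w)).
  by have := Y0 w; have := sqr_ge0 (Y w); lra.
Qed.

End stretched_moment.

(** * Generating functions of one variable *)

Section one_variable.
Context d (T : measurableType d) (R : realType) (P : probability T R).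
Local Open Scope ereal_scope.
Variables (Y : {RV P >-> R}) (r c m M : R).
Hypothesis Y0 : forall w, (0 <= Y w)%R.
Hypothesis Ym : \int[P]_w (Y w)%:E = m%:E.
Hypothesis c0 : (0 < c)%R.
Hypothesis YM :
  \int[P]_w (stretched_weight r c (Y w))%:E <= M%:E.

Let W := @stretched_weight R r c.
Let mW : measurable_fun setT (fun w => (W (Y w))%:E).
Proof.
apply/measurable_EFinP.
exact: (measurableT_comp (measurable_stretched_weight r c)).
Qed.

Lemma integral_quadratic_le (k s : R) : (0 <= k)%R -> (0 <= s)%R ->
  \int[P]_w (1 + s * Y w + k * W (Y w))%:E <= (1 + s * m + k * M)%:E.
Proof.
move=> k0 s0.
under eq_integral do rewrite EFinD.
rewrite ge0_integralD//=; last 4 first.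
- by move=> w _; rewrite lee_fin addr_ge0// mulr_ge0.
- by apply/measurable_EFinP; apply: measurable_funD => //; exact: measurable_funM.
- by move=> w _; rewrite lee_fin mulr_ge0// stretched_weight_ge0.
- by under eq_fun do rewrite EFinM; apply: emeasurable_funM.
rewrite EFinD; apply: leeD; last first.
  under eq_integral do rewrite EFinM.
  rewrite ge0_integralZl//; last first.
    by move=> w _; rewrite lee_fin stretched_weight_ge0.
  by rewrite EFinM lee_wpmul2l.
under eq_integral do rewrite EFinD.
rewrite ge0_integralD//=; last 2 first.
- by move=> w _; rewrite lee_fin mulr_ge0.
- by apply/measurable_EFinP; exact: measurable_funM.
rewrite integral_cst// [X in _ * X + _]probability_setT mule1 EFinD leeD2l//.
under eq_integral do rewrite EFinM.
rewrite ge0_integralZl//; last 2 first.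
- exact/measurable_EFinP.
- by move=> w _; rewrite lee_fin.
by rewrite Ym EFinM.
Qed.

(** On [B] the exponential factor of the second order Taylor bound is at most
    [exp (c Y ^ r)], so the remainder is at most [s ^ 2] times the stretched
    weight. *)
Lemma truncated_mgf_le (B : set R) (s : R) : measurable B -> (0 <= s)%R ->
  (forall t, (0 <= t)%R -> B t -> (s * t <= c * t `^ r)%R) ->
  \int[P]_w (expR (s * Y w) * \1_B (Y w))%:E
    <= (expR (s * m + s ^+ 2 * M))%:E.
Proof.
move=> mB s0 Bs.
apply: (@le_trans _ _ (1 + s * m + s ^+ 2 * M)%:E); last first.
  by rewrite lee_fin -addrA; exact: expR_ge1Dx.
apply: le_trans (integral_quadratic_le (sqr_ge0 s) s0).
apply: ge0_le_integral => //.
- apply/measurable_EFinP; apply: measurable_funM.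
    by apply: measurableT_comp => //; exact: measurable_funM.
  by apply: measurableT_comp => //; exact: measurable_indic.
- apply/measurable_EFinP; apply: measurable_funD.
    by apply: measurable_funD => //; exact: measurable_funM.
  by apply: measurable_funM => //; exact/measurable_EFinP.
- move=> w _; rewrite lee_fin.
  have t0 := Y0 w; have st0 : (0 <= s * Y w)%R by exact: mulr_ge0.
  rewrite indicE; have [/set_mem Bw|_] := boolP (Y w \in B); last first.
    by rewrite mulr0 !addr_ge0// mulr_ge0 ?sqr_ge0// stretched_weight_ge0.
  rewrite mulr1; apply: (le_trans (expR_le_quadratic st0)).
  rewrite lerD2l exprMn -mulrA ler_wpM2l ?sqr_ge0//.
  apply: le_trans (sqr_expR_le_stretched_weight _ _ t0).
  rewrite ler_wpM2l ?sqr_ge0// ler_expR.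
  exact: Bs.
Qed.

(** The term [s m] stays on the left until the end, so that only integrals of
    non-negative functions are compared. *)
Lemma laplace_le (s : R) : (0 <= s)%R ->
  \int[P]_w (expR (- (s * Y w)))%:E <= (expR (- (s * m) + s ^+ 2 * M))%:E.
Proof.
move=> s0.
have mE : measurable_fun setT (fun w => expR (- (s * Y w))).
  by do 2 apply: measurableT_comp => //; exact: measurable_funM.
set I := (X in X <= _).
have I0 : 0 <= I by apply: integral_ge0 => w _; rewrite lee_fin expR_ge0.
suff h : I + (s * m)%:E <= (1 + s ^+ 2 * M)%:E.
  have fI : I \is a fin_num.
    rewrite ge0_fin_numE//; apply: (@le_lt_trans _ _ (I + (s * m)%:E)).
      rewrite leeDl// lee_fin mulr_ge0//.
      by rewrite -lee_fin -Ym; apply: integral_ge0 => w _; rewrite lee_fin.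
    by apply: le_lt_trans h _; exact: ltry.
  move: h; rewrite -(fineK fI) -EFinD !lee_fin => h.
  have := expR_ge1Dx (- (s * m) + s ^+ 2 * M); lra.
have <- : \int[P]_w (expR (- (s * Y w)) + s * Y w)%:E = I + (s * m)%:E.
  under eq_integral do rewrite EFinD.
  rewrite ge0_integralD//=; last 3 first.
  - exact/measurable_EFinP.
  - by move=> w _; rewrite lee_fin mulr_ge0.
  - by apply/measurable_EFinP; exact: measurable_funM.
  congr (_ + _); under eq_integral do rewrite EFinM.
  rewrite ge0_integralZl ?Ym//.
    exact/measurable_EFinP.
  by move=> w _; rewrite lee_fin.
have := integral_quadratic_le (sqr_ge0 s) (lexx 0%R).
rewrite mul0r addr0; apply: le_trans.
apply: ge0_le_integral => //.
- by move=> w _; rewrite lee_fin addr_ge0 ?expR_ge0 ?mulr_ge0.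
- by apply/measurable_EFinP; apply: measurable_funD => //; exact: measurable_funM.
- apply/measurable_EFinP; apply: measurable_funD.
    by apply: measurable_funD => //; exact: measurable_funM.
  by apply: measurable_funM => //; exact/measurable_EFinP.
- move=> w _; rewrite lee_fin mul0r addr0.
  have t0 := Y0 w; have st0 : (0 <= s * Y w)%R by exact: mulr_ge0.
  have h := expRN_le_quadratic st0.
  have hW : (Y w ^+ 2 <= W (Y w))%R.
    apply: le_trans (quadratic_le_stretched_weight _ (ltW c0) t0).
    by rewrite lerDr addr_ge0.
  have : (s ^+ 2 * Y w ^+ 2 <= s ^+ 2 * W (Y w))%R.
    by rewrite ler_wpM2l ?sqr_ge0.
  by move: h; rewrite exprMn; lra.
Qed.

End one_variable.

(** * Finite weighted sums *)

Lemma measurable_weighted_sum_gt d (T : measurableType d) (R : realType)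
    (P : probability T R) (Xs : nat -> {RV P >-> R}) (a : nat -> R) N (x : R) :
  measurable [set w | x < \sum_(i < N) a i * Xs i w].
Proof.
rewrite (_ : mkset _ = setT `&`
    (fun w => \sum_(i < N) a i * Xs i w) @^-1` `]x, +oo[%classic); last first.
  by rewrite setTI; apply/seteqP; split => w /=; rewrite in_itv/= andbT.
have mS : measurable_fun setT (fun w => \sum_(i < N) a i * Xs i w).
  by apply: measurable_sum => i; exact: measurable_funM.
exact: mS.
Qed.

Section finite_sum.
Context d (T : measurableType d) (R : realType) (P : probability T R).
Local Open Scope ereal_scope.
Variables (Xs : nat -> {RV P >-> R}) (r c m M : R).
Hypothesis Xs0 : forall i w, (0 <= Xs i w)%R.
Hypothesis Xs_indep : mutually_independent Xs.
Hypothesis Xs_law : forall i, same_law (Xs i) (Xs 0%N).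
Hypothesis r0 : (0 < r)%R.
Hypothesis r1 : (r < 1)%R.
Hypothesis c0 : (0 < c)%R.
Hypothesis Xm : \int[P]_w (Xs 0%N w)%:E = m%:E.
Hypothesis XM :
  \int[P]_w (stretched_weight r c (Xs 0%N w))%:E <= M%:E.
Implicit Types (a : nat -> R) (N : nat).

Let m_ge0 : (0 <= m)%R.
Proof.
by rewrite -lee_fin -Xm; apply: integral_ge0 => w _; rewrite lee_fin.
Qed.

Let M_ge0 : (0 <= M)%R.
Proof.
rewrite -lee_fin; apply: le_trans XM; apply: integral_ge0 => w _.
by rewrite lee_fin stretched_weight_ge0.
Qed.

Lemma integral_comp_same (g : R -> R) i :
  measurable_fun setT g -> (forall t, (0 <= t)%R -> (0 <= g t)%R) ->
  \int[P]_w (g (Xs i w))%:E = \int[P]_w (g (Xs 0%N w))%:E.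
Proof.
move=> mg g0.
transitivity (\int[P]_w (EFin \o (fun t => `|g t|%R)) (Xs i w)).
  by apply: eq_integral => w _ /=; rewrite ger0_norm// g0.
rewrite (same_law_integral (Xs_law i)).
- by apply: eq_integral => w _ /=; rewrite ger0_norm// g0.
- by apply/measurable_EFinP; apply: measurableT_comp.
- by move=> y; rewrite lee_fin.
Qed.

(** The two summands of the bound are the two scenarios, a term above [y] and
    all terms at most [y]. The event is dominated pointwise by
    [\sum_i u_i (X_i) + exp (- theta x) \prod_i g_i (X_i)], where [u_i] comes
    from a Markov bound for the event that the term of index [i] exceeds [y]
    and [g_i] is the truncated exponential. *)
Lemma weighted_sum_upper_bound a N (x y alpha A : R) :
  (0 < alpha)%R -> (0 < y)%R ->
  (forall i, (0 <= a i <= alpha)%R) -> (\sum_(i < N) a i <= A)%R ->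
  let theta := (c * (y `^ (r - 1) / alpha `^ r))%R in
  P [set w | (x < \sum_(i < N) a i * Xs i w)%R] <=
   (A * M / y * expR (- (c * (y / alpha) `^ r)) +
    expR (- (theta * (x - m * A - theta * M * alpha * A))))%:E.
Proof.
move=> al0 y0 aP aA; set theta := (c * _)%R; cbv zeta.
have a0 i : (0 <= a i)%R by have /andP[] := aP i.
have aal i : (a i <= alpha)%R by have /andP[] := aP i.
have m0 := m_ge0; have M0 := M_ge0.
have theta0 : (0 <= theta)%R by rewrite !mulr_ge0 ?invr_ge0 ?powR_ge0// ltW.
pose E0 := expR (- (c * (y / alpha) `^ r)).
pose W := @stretched_weight R r c.
pose u i (t : R) : R := (a i / y * E0 * W t)%R.
pose B i : set R := [set t | (a i * t <= y)%R].
pose g i (t : R) : R := (expR (theta * a i * t) * \1_(B i) t)%R.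
have mB i : measurable (B i).
  have -> : B i = setT `&` (fun t => a i * t)%R @^-1` `]-oo, y]%classic.
    by rewrite setTI; apply/seteqP; split => w /=; rewrite in_itv.
  have : measurable_fun setT (fun t : R => a i * t)%R by exact: measurable_funM.
  by move=> h; exact: h.
have mg i : measurable_fun setT (g i).
  apply: measurable_funM; last exact: measurable_indic.
  by apply: measurableT_comp => //; exact: measurable_funM.
have g0 i t : (0 <= g i t)%R by rewrite mulr_ge0 ?expR_ge0// indicE ler0n.
have u0 i w : (0 <= u i (Xs i w))%R.
  apply: mulr_ge0; last exact: stretched_weight_ge0.
  by rewrite !mulr_ge0 ?invr_ge0 ?(ltW y0) ?expR_ge0.
have mu i : measurable_fun setT (fun w => u i (Xs i w)).
  apply: measurable_funM => //.
  exact: (measurableT_comp (measurable_stretched_weight r c)).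
set S := [set w | _].
have mSet : measurable S by exact: measurable_weighted_sum_gt.
have mgp : measurable_fun setT (fun w => \prod_(i < N) g i (Xs i w))%R.
  by apply: measurable_prod => i _; exact: measurableT_comp.
have pw w : (\1_S w <= \sum_(i < N) u i (Xs i w) +
               expR (- (theta * x)) * \prod_(i < N) g i (Xs i w))%R.
  have p0 : (0 <= \prod_(i < N) g i (Xs i w))%R by apply: prodr_ge0.
  rewrite indicE; have [/set_mem Sw|_] := boolP (w \in S); last first.
    by rewrite addr_ge0 ?sumr_ge0 ?mulr_ge0 ?expR_ge0.
  have [/existsNP[i /negP]|all_le] :=
    pselect (~ forall i : 'I_N, (a i * Xs i w <= y)%R).
    rewrite -ltNge => big_i.
    rewrite (bigD1 i)//= -addrA ler_wpDr//.
      by rewrite addr_ge0 ?sumr_ge0 ?mulr_ge0 ?expR_ge0.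
    have t0 := Xs0 i w.
    have h1 : (y / alpha <= Xs i w)%R.
      rewrite ler_pdivrMr// mulrC (le_trans (ltW big_i))//.
      by rewrite ler_wpM2r.
    have h2 : (1 <= E0 * expR (c * Xs i w `^ r))%R.
      rewrite /E0 -expRD; apply: le_trans (expR_ge1Dx _).
      rewrite lerDl addrC subr_ge0 ler_pM2l//.
      by apply: ge0_ler_powR; rewrite ?nnegrE ?(ltW r0)// divr_ge0// ltW.
    have h3 : (1 <= a i / y * (1 + Xs i w + Xs i w ^+ 2))%R.
      rewrite mulrAC ler_pdivlMr// mul1r (le_trans (ltW big_i))// ler_wpM2l//.
      by have := sqr_ge0 (Xs i w); lra.
    rewrite /u /W /stretched_weight.
    rewrite (_ : (_ * _)%R = (a i / y * (1 + Xs i w + Xs i w ^+ 2)) *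
        (E0 * expR (c * Xs i w `^ r)))%R; last by ring.
    exact: mulr_ege1.
  have {}all_le i : (i < N)%N -> (a i * Xs i w <= y)%R.
    by move=> iN; move/contrapT: all_le => /(_ (Ordinal iN)).
  rewrite ler_wpDl ?sumr_ge0//.
  rewrite (_ : \prod_(i < N) _ =
      expR (theta * \sum_(i < N) a i * Xs i w))%R; last first.
    rewrite mulr_sumr expR_sum; apply: eq_bigr => i _.
    by rewrite /g indicE mem_set ?mulr1 ?mulrA//; exact: all_le.
  rewrite -expRD; apply: le_trans (expR_ge1Dx _).
  by rewrite lerDl addrC subr_ge0 ler_wpM2l// ltW.
rewrite -[P S]/(P S) -(setIT S) -integral_indic//.
apply: (@le_trans _ _ (\int[P]_w (\sum_(i < N) u i (Xs i w) +
               expR (- (theta * x)) * \prod_(i < N) g i (Xs i w))%:E)).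
  apply: ge0_le_integral => //.
  - exact/measurable_EFinP.
  - apply/measurable_EFinP; apply: measurable_funD.
      exact: measurable_sum.
    exact: measurable_funM.
  - by move=> w _; rewrite lee_fin.
under eq_integral do rewrite EFinD.
rewrite ge0_integralD//=; last 4 first.
- by move=> w _; rewrite lee_fin sumr_ge0.
- by apply/measurable_EFinP; exact: measurable_sum.
- by move=> w _; rewrite lee_fin mulr_ge0 ?expR_ge0// prodr_ge0.
- by apply/measurable_EFinP; exact: measurable_funM.
rewrite EFinD; apply: leeD.
  under eq_integral do rewrite -sumEFin.
  rewrite ge0_integral_sum//; last 2 first.
  - by move=> i; apply/measurable_EFinP.
  - by move=> i w _; rewrite lee_fin.
  apply: (@le_trans _ _ (\sum_(i < N) (a i * (E0 * M / y))%:E)).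
    apply: lee_sum => i _; under eq_integral do rewrite EFinM.
    rewrite ge0_integralZl//; last 3 first.
    - apply/measurable_EFinP.
      exact: (measurableT_comp (measurable_stretched_weight r c)).
    - by move=> w _; rewrite lee_fin stretched_weight_ge0.
    - by rewrite lee_fin !mulr_ge0 ?invr_ge0 ?(ltW y0) ?expR_ge0.
    rewrite (@integral_comp_same W); last 2 first.
    - exact: measurable_stretched_weight.
    - exact: stretched_weight_ge0.
    rewrite (_ : (a i * (E0 * M / y))%R = (a i / y * E0 * M)%R); last by ring.
    rewrite [leRHS]EFinM lee_wpmul2l// lee_fin.
    by rewrite !mulr_ge0 ?invr_ge0 ?(ltW y0) ?expR_ge0.
  rewrite sumEFin lee_fin -mulr_suml.
  rewrite (_ : (A * M / y * _)%R = (A * (E0 * M / y))%R); last first.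
    by rewrite /E0; ring.
  by rewrite ler_wpM2r// !mulr_ge0 ?invr_ge0 ?(ltW y0) ?expR_ge0.
under eq_integral do rewrite EFinM.
rewrite ge0_integralZl//; last 2 first.
- exact/measurable_EFinP.
- by move=> w _; rewrite lee_fin prodr_ge0.
pose b i := expR (theta * a i * m + (theta * a i) ^+ 2 * M).
apply: (@le_trans _ _ ((expR (- (theta * x)))%:E * (\prod_(i < N) b i)%:E)).
  rewrite lee_wpmul2l ?lee_fin ?expR_ge0//.
  apply: integral_prod_indep_le => // i.
  rewrite integral_comp_same//.
  apply: (@truncated_mgf_le _ _ _ _ (Xs 0%N) r c m M) => //.
    by rewrite mulr_ge0.
  move=> t t0 Bt; apply: truncated_exponent_le => //; exact: ltW.
rewrite -EFinM lee_fin -expR_sum -expRD ler_expR.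
rewrite [leLHS](_ : _ = - (theta * x) + theta * m * (\sum_(i < N) a i) +
   theta ^+ 2 * M * (\sum_(i < N) a i ^+ 2))%R; last first.
  rewrite big_split/= -addrA; congr (_ + (_ + _))%R.
    by rewrite mulr_sumr; apply: eq_bigr => i _; ring.
  by rewrite mulr_sumr; apply: eq_bigr => i _; ring.
have h2 : (\sum_(i < N) a i ^+ 2 <= alpha * A)%R.
  apply: (@le_trans _ _ (alpha * \sum_(i < N) a i)%R).
    by rewrite mulr_sumr; apply: ler_sum => i _; rewrite expr2 ler_wpM2r.
  by rewrite ler_wpM2l// ltW.
have h3 : (theta * m * (\sum_(i < N) a i) <= theta * m * A)%R.
  by rewrite ler_wpM2l// mulr_ge0.
have h4 : (theta ^+ 2 * M * (\sum_(i < N) a i ^+ 2) <=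
    theta ^+ 2 * M * (alpha * A))%R.
  by rewrite ler_wpM2l// mulr_ge0// sqr_ge0.
rewrite [leRHS](_ : _ = - (theta * x) + theta * m * A +
   theta ^+ 2 * M * (alpha * A))%R; last by ring.
by rewrite !lerD.
Qed.

(** If the term of index [i0] exceeds [x - c'] but the sum does not exceed [x],
    the other terms sum to less than [c']. By independence the probability of
    that is at most the probability of the jump times a Laplace transform
    bound, which the last hypothesis makes at most [exp (- 1)], hence at most
    one half. The weights of the other terms sum to at least [A - 2 alpha]: one
    [alpha] is the weight of index [i0], the other is the slack of the partial
    sum. *)
Lemma weighted_sum_lower_bound a N (i0 : 'I_N) (x c' alpha theta A : R) :
  (0 < alpha)%R -> (0 <= theta)%R ->
  (forall i, (0 <= a i <= alpha)%R) -> a i0 = alpha ->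
  (A - alpha <= \sum_(i < N) a i <= A)%R ->
  (1 <= theta * (m * (A - 2 * alpha) - theta * M * alpha * A - c'))%R ->
  P [set w | ((x - c') / alpha < Xs 0%N w)%R] <=
  2%:E * P [set w | (x < \sum_(i < N) a i * Xs i w)%R].
Proof.
move=> al0 theta0 aP ai0 /andP[lA uA] big.
have a0 i : (0 <= a i)%R by have /andP[] := aP i.
have aal i : (a i <= alpha)%R by have /andP[] := aP i.
have m0 := m_ge0; have M0 := M_ge0.
pose B := `]((x - c') / alpha)%R, +oo[%classic : set R.
have BE i : [set w | ((x - c') / alpha < Xs i w)%R] = Xs i @^-1` B.
  by apply/seteqP; split => w; rewrite /B /= in_itv/= andbT.
have mB : measurable B by exact: measurable_itv.
have mXB i : measurable (Xs i @^-1` B).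
  by rewrite -[X in measurable X]setTI; exact: measurable_funPT.
set S := [set w | (x < \sum_(i < N) a i * Xs i w)%R].
have mS : measurable S by exact: measurable_weighted_sum_gt.
rewrite BE -[P (_ @^-1` _)]/(distribution P (Xs 0%N) B) -(Xs_law i0)//.
rewrite -[distribution _ _ _]/(P (Xs i0 @^-1` B)).
set p := P (Xs i0 @^-1` B).
have fp : p \is a fin_num by exact: fin_num_measure.
have p0 : (0 <= fine p)%R by apply: fine_ge0; exact: measure_ge0.
(* The jump is the factor of index [i0], the Laplace factors are the others. *)
pose g (i : nat) (t : R) : R :=
  if i == i0 then \1_B t else expR (- (theta * a i * t)).
pose b (i : nat) : R := if i == i0 then fine p
  else expR (- (theta * a i * m) + (theta * a i) ^+ 2 * M).
have mg i : measurable_fun setT (g i).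
  rewrite /g; case: (i == i0); first exact: (measurable_indic mB).
  by do 2 apply: measurableT_comp => //; exact: measurable_funM.
have g0 i t : (0 <= g i t)%R.
  by rewrite /g; case: ifP => _; rewrite ?expR_ge0// indicE ler0n.
have gb i : \int[P]_w (g i (Xs i w))%:E <= (b i)%:E.
  have [->|ii0] := eqVneq i (i0 : nat).
    rewrite /g /b eqxx fineK//.
    rewrite -[leLHS]/(\int[P]_w (\1_(Xs i0 @^-1` B) w)%:E).
    by rewrite integral_indic// setIT.
  rewrite integral_comp_same// /g /b (negbTE ii0).
  apply: (@laplace_le _ _ _ _ (Xs 0%N) r c m M) => //.
  by rewrite mulr_ge0.
have mgp : measurable_fun setT (fun w => \prod_(i < N) g i (Xs i w))%R.
  by apply: measurable_prod => i _; exact: measurableT_comp.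
have pw w : (\1_(Xs i0 @^-1` B) w <= \1_S w +
               expR (theta * c') * \prod_(i < N) g i (Xs i w))%R.
  have pg0 : (0 <= \prod_(i < N) g i (Xs i w))%R by apply: prodr_ge0.
  have [Bw|Bw] := boolP (w \in Xs i0 @^-1` B); last first.
    by rewrite indicE (negbTE Bw) addr_ge0 ?mulr_ge0 ?expR_ge0// indicE ler0n.
  have [Sw|Sw] := boolP (w \in S).
    by rewrite !indicE Bw Sw lerDl mulr_ge0 ?expR_ge0.
  rewrite !indicE Bw (negbTE Sw) add0r (bigD1 i0)//= {1}/g eqxx.
  rewrite indicE mem_set ?mul1r; last by move/set_mem: Bw.
  rewrite (eq_bigr (fun i : 'I_N => expR (- (theta * a i * Xs i w)))); last first.
    by move=> i ii0; rewrite /g ifN.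
  rewrite -expR_sum -expRD; apply: le_trans (expR_ge1Dx _).
  rewrite lerDl sumrN subr_ge0.
  rewrite (_ : \sum_(i < N | i != i0) _ =
    theta * \sum_(i < N | i != i0) a i * Xs i w)%R; last first.
    by rewrite mulr_sumr; apply: eq_bigr => i _; rewrite mulrA.
  rewrite ler_wpM2l//.
  move/negP: Sw => Sw.
  have : (\sum_(i < N) a i * Xs i w <= x)%R.
    by rewrite leNgt; apply/negP => h; apply: Sw; exact/mem_set.
  move/set_mem: Bw; rewrite -BE /= ltr_pdivrMr// (bigD1 i0)//= ai0; lra.
have Ele : p <= P S + (expR (theta * c'))%:E * (\prod_(i < N) b i)%:E.
  rewrite /p -(setIT (_ @^-1` _)) -integral_indic//.
  apply: (@le_trans _ _ (\int[P]_w (\1_S w +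
               expR (theta * c') * \prod_(i < N) g i (Xs i w))%:E)).
    apply: ge0_le_integral => //.
    - exact/measurable_EFinP.
    - apply/measurable_EFinP; apply: measurable_funD => //.
      exact: measurable_funM.
    - by move=> w _; rewrite lee_fin.
  under eq_integral do rewrite EFinD.
  rewrite ge0_integralD//=; last 3 first.
  - exact/measurable_EFinP.
  - by move=> w _; rewrite lee_fin mulr_ge0 ?expR_ge0// prodr_ge0.
  - by apply/measurable_EFinP; exact: measurable_funM.
  rewrite integral_indic// setIT leeD2l//.
  under eq_integral do rewrite EFinM.
  rewrite ge0_integralZl//; last 2 first.
  - exact/measurable_EFinP.
  - by move=> w _; rewrite lee_fin prodr_ge0.
  rewrite lee_wpmul2l ?lee_fin ?expR_ge0//.
  exact: integral_prod_indep_le.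
have fS : P S \is a fin_num by exact: fin_num_measure.
move: Ele; rewrite -(fineK fS) -(fineK fp) -EFinM -EFinD -EFinM !lee_fin.
suff : (expR (theta * c') * (\prod_(i < N) b i) <= fine p / 2)%R by lra.
rewrite (bigD1 i0)//= {1}/b eqxx mulrCA ler_wpM2l//.
rewrite (eq_bigr (fun i : 'I_N =>
  expR (- (theta * a i * m) + (theta * a i) ^+ 2 * M)))%R; last first.
  by move=> i ii0; rewrite /b ifN.
rewrite -expR_sum -expRD.
apply: (@le_trans _ _ (expR (- 1))); last first.
  by rewrite expRN lef_pV2 ?posrE ?expR_gt0// (le_trans _ (expR_ge1Dx 1)).
rewrite ler_expR.
rewrite [leLHS](_ : _ = theta * c' - theta * m * (\sum_(i < N | i != i0) a i) +
   theta ^+ 2 * M * (\sum_(i < N | i != i0) a i ^+ 2))%R; last first.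
  rewrite big_split/= -addrA; congr (_ + (_ + _))%R.
    by rewrite mulr_sumr -sumrN; apply: eq_bigr => i _; ring.
  by rewrite mulr_sumr; apply: eq_bigr => i _; ring.
have hA : (A - 2 * alpha <= \sum_(i < N | i != i0) a i <= A)%R.
  by move: lA uA; rewrite (bigD1 i0)//= ai0; lra.
have /andP[h1 h1'] := hA.
have h2 : (\sum_(i < N | i != i0) a i ^+ 2 <= alpha * A)%R.
  apply: (@le_trans _ _ (alpha * \sum_(i < N | i != i0) a i)%R).
    by rewrite mulr_sumr; apply: ler_sum => i _; rewrite expr2 ler_wpM2r.
  by rewrite ler_wpM2l// ltW.
have h3 : (theta * m * (A - 2 * alpha) <=
    theta * m * (\sum_(i < N | i != i0) a i))%R.
  by rewrite ler_wpM2l// mulr_ge0.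
have h4 : (theta ^+ 2 * M * (\sum_(i < N | i != i0) a i ^+ 2) <=
    theta ^+ 2 * M * (alpha * A))%R.
  by rewrite ler_wpM2l// mulr_ge0// sqr_ge0.
apply: (@le_trans _ _ (theta * c' - theta * m * (A - 2 * alpha) +
   theta ^+ 2 * M * (alpha * A))%R); first by lra.
rewrite [leLHS](_ : _ =
    - (theta * (m * (A - 2 * alpha) - theta * M * alpha * A - c')))%R; last by ring.
by rewrite lerN2.
Qed.

End finite_sum.

(** * From finite sums to series *)

Section series.
Context d (T : measurableType d) (R : realType) (P : probability T R).
Local Open Scope ereal_scope.
Variables (Xs : nat -> {RV P >-> R}) (b : nat -> R) (x : R).
Hypothesis Xs0 : forall i w, (0 <= Xs i w)%R.
Hypothesis b0 : forall i, (0 <= b i)%R.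

Let S N := [set w | (x < \sum_(i < N) b i * Xs i w)%R].
Let Soo := [set w | x%:E < \sum_(i <oo) (b i * Xs i w)%:E].

Let term_ge0 i w : (0 <= (b i * Xs i w)%:E).
Proof. by rewrite lee_fin mulr_ge0. Qed.

Let partialE N w :
  \sum_(0 <= i < N) (b i * Xs i w)%:E = (\sum_(i < N) b i * Xs i w)%:E.
Proof. by rewrite big_mkord sumEFin. Qed.

Let mS N : measurable (S N).
Proof. exact: measurable_weighted_sum_gt. Qed.

Let SooE : Soo = \bigcup_N S N.
Proof.
apply/seteqP; split => w /=.
  rewrite /Soo /= => h; apply: contrapT => nS.
  move: h; apply/negP; rewrite -leNgt.
  apply: lime_le; first exact: is_cvg_nneseries.
  apply: nearW => N; rewrite partialE lee_fin leNgt; apply/negP => h.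
  by apply: nS; exists N.
move=> [N _ h]; rewrite /Soo /=.
apply: (@lt_le_trans _ _ (\sum_(i < N) b i * Xs i w)%:E).
  by rewrite lte_fin.
by rewrite -partialE; exact: nneseries_lim_ge.
Qed.

Let mSoo : measurable Soo.
Proof. by rewrite SooE; exact: bigcup_measurable. Qed.

Lemma le_probability_series N : P (S N) <= P Soo.
Proof.
by apply: le_measure; rewrite ?inE// SooE => w Sw; exists N.
Qed.

Lemma probability_series_le B : (forall N, P (S N) <= B) -> P Soo <= B.
Proof.
move=> SB.
have cv : (P \o S) n @[n --> \oo] --> P Soo.
  rewrite SooE; apply: nondecreasing_cvg_mu => //; first by rewrite -SooE.
  move=> n k nk; apply/subsetPset => w; rewrite /S /= => h.
  apply: lt_le_trans h _; rewrite -lee_fin -!partialE.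
  exact: lee_sum_nneg_natr.
by rewrite -(cvg_lim _ cv)//; apply: lime_le; [exact: cvgP cv|exact: nearW].
Qed.

End series.

(** * Logarithmic asymptotics *)

Section limits.
Context {R : realType}.

Lemma cvg_powR0 (alpha : nat -> R) (s : R) : 0 < s -> (forall n, 0 < alpha n) ->
  alpha n @[n --> \oo] --> 0 -> alpha n `^ s @[n --> \oo] --> 0.
Proof.
move=> s0 al0 /cvgrPdist_lt cv; apply/cvgrPdist_lt => e e0.
have e1 : 0 < e `^ s^-1 by exact: powR_gt0.
near=> n.
have : `|0 - alpha n| < e `^ s^-1 by near: n; exact: cv.
rewrite !sub0r !normrN !gtr0_norm ?powR_gt0// => h.
rewrite (_ : e = (e `^ s^-1) `^ s); last first.
  by rewrite -powRrM mulVf ?gt_eqF// powRr1// ltW.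
by apply: gt0_ltr_powR; rewrite ?nnegrE ?powR_ge0// ltW.
Unshelve. all: by end_near. Qed.

(** After taking logarithms and multiplying by [alpha n ^ r], the constants [C]
    become negligible and [delta] can be made arbitrarily small. *)
Lemma cvg_log_sandwich (p : nat -> \bar R) (alpha : nat -> R) (r L : R) :
  0 < r -> 0 <= L -> (forall n, 0 < alpha n) -> alpha n @[n --> \oo] --> 0 ->
  (forall n, (0 <= p n)%E) ->
  (forall delta : R, 0 < delta -> delta < 1 ->
   exists2 C, 0 < C & \forall n \near \oo,
     (p n <= (C * expR (- (L * (1 - delta) ^+ 2 / alpha n `^ r)))%:E)%E) ->
  (forall delta : R, 0 < delta -> delta < 1 ->
   exists2 C, 0 < C & \forall n \near \oo,
     ((C * expR (- (L * (1 + delta) ^+ 2 / alpha n `^ r)))%:E <= p n)%E) ->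
  ((alpha n `^ r)%:E * lne (p n))%E @[n --> \oo] --> (- L)%:E.
Proof.
move=> r0 L0 al0 al_cv p0 up lo.
have ar_cv := cvg_powR0 r0 al0 al_cv.
have lnC (C e : R) : 0 < e -> \forall n \near \oo, `|alpha n `^ r * ln C| <= e.
  move=> e0.
  have : alpha n `^ r * ln C @[n --> \oo] --> 0 * ln C by exact: cvgMl.
  rewrite mul0r => /cvgrPdist_le /(_ _ e0); apply: filterS => n.
  by rewrite sub0r normrN.
have logE C q n : 0 < C ->
  ((alpha n `^ r)%:E * lne (C * expR (- (q / alpha n `^ r)))%:E)%E =
    (alpha n `^ r * ln C - q)%:E.
  move=> C0; rewrite lne_EFin ?mulr_gt0 ?expR_gt0//.
  rewrite lnM ?posrE ?expR_gt0// expRK -EFinM mulrDr mulrN mulrCA mulfV ?mulr1//.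
  by rewrite gt_eqF// powR_gt0.
have main e : 0 < e -> \forall n \near \oo,
    ((- (L + e))%:E <= (alpha n `^ r)%:E * lne (p n) <= (- (L - e))%:E)%E.
  move=> e0.
  (* As [delta < 1], [L (1 + delta) ^ 2 <= L + 3 delta L <= L + e / 2]. *)
  pose delta := e / (e + 6 * (L + 1)).
  have den0 : 0 < e + 6 * (L + 1) by lra.
  have delta0 : 0 < delta by exact: divr_gt0.
  have delta1 : delta < 1 by rewrite ltr_pdivrMr// mul1r; lra.
  have dL : 6 * (delta * L) <= e.
    rewrite /delta mulrAC mulrA ler_pdivrMr//; nra.
  have dL0 : 0 <= delta * L by rewrite mulr_ge0// ltW.
  have e20 : 0 < e / 2 by rewrite divr_gt0.
  have [C C0 HC] := up _ delta0 delta1.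
  have [C' C'0 HC'] := lo _ delta0 delta1.
  near=> n; apply/andP; split.
    have h : `|alpha n `^ r * ln C'| <= e / 2 by near: n; exact: lnC.
    have : ((C' * expR (- (L * (1 + delta) ^+ 2 / alpha n `^ r)))%:E <= p n)%E.
      by near: n.
    rewrite -lee_lne ?in_itv/= ?leey ?p0 ?lee_fin ?mulr_ge0 ?expR_ge0 ?(ltW C'0)//.
    rewrite -(@lee_pmul2l _ (alpha n `^ r)%:E) ?lte_fin ?powR_gt0//.
    rewrite logE//; apply: le_trans; rewrite lee_fin.
    move: h; rewrite ler_norml => /andP[h _]; nra.
  have h : `|alpha n `^ r * ln C| <= e / 2 by near: n; exact: lnC.
  have : (p n <= (C * expR (- (L * (1 - delta) ^+ 2 / alpha n `^ r)))%:E)%E.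
    by near: n.
  rewrite -lee_lne ?in_itv/= ?leey ?p0 ?lee_fin ?mulr_ge0 ?expR_ge0 ?(ltW C0)//.
  rewrite -(@lee_pmul2l _ (alpha n `^ r)%:E) ?lte_fin ?powR_gt0//.
  rewrite logE// => /le_trans; apply; rewrite lee_fin.
  move: h; rewrite ler_norml => /andP[_ h]; nra.
apply/fine_cvgP; split.
  near=> n.
  have /andP[h1 h2] :
      ((- (L + 1))%:E <= (alpha n `^ r)%:E * lne (p n) <= (- (L - 1))%:E)%E.
    by near: n; exact: main.
  rewrite fin_numE; apply/andP; split; apply/eqP => h.
    by move: h1; rewrite h.
  by move: h2; rewrite h.
apply/cvgrPdist_le => e e0; near=> n.
have : ((- (L + e))%:E <= (alpha n `^ r)%:E * lne (p n) <= (- (L - e))%:E)%E.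
  by near: n; exact: main.
rewrite /=; case: (_ * _)%E => [z| |]; [|by case/andP|by case/andP].
rewrite !lee_fin /= => /andP[h1 h2]; rewrite ler_norml; apply/andP; split; lra.
Unshelve. all: by end_near. Qed.

End limits.

Section tail_of_series.
Context d (T : measurableType d) (R : realType) (P : probability T R).
Variables (r kappa : R) (Xs : nat -> {RV P >-> R}) (a : nat -> nat -> R)
  (amax : nat -> R) (D m : R).
Hypotheses (r_gt0 : 0 < r) (r_lt1 : r < 1) (kappa_gt0 : 0 < kappa).
Hypothesis Xs_ge0 : forall i w, 0 <= Xs i w.
Hypothesis Xs_indep : mutually_independent Xs.
Hypothesis Xs_law : forall i, same_law (Xs i) (Xs 0%N).
Hypothesis X_mean : (\int[P]_w (Xs 0%N w)%:E = m%:E)%E.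
Hypothesis X_tail : forall delta, 0 < delta -> \forall t \near +oo,
  ((expR (- (kappa * (1 + delta) * t `^ r)))%:E <= P [set w | (t < Xs 0%N w)%R]
      <= (expR (- (kappa * (1 - delta) * t `^ r)))%:E)%E.
Hypothesis a_ge0 : forall i n, 0 <= a i n.
Hypothesis D_ge0 : 0 <= D.
Hypothesis a_sum : (\sum_(i <oo) (a i n)%:E)%E @[n --> \oo] --> D%:E.
Hypothesis amaxP : forall n, is_maximum (range (a^~ n)) (amax n).
Hypothesis amax_gt0 : forall n, 0 < amax n.
Hypothesis amax_to0 : amax n @[n --> \oo] --> 0.

Let p x n := P [set w | (x%:E < \sum_(i <oo) (a i n * Xs i w)%:E)%E].
Let A n := fine (\sum_(i <oo) (a i n)%:E)%E.

Let a_le i n : a i n <= amax n.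
Proof. by have [_] := amaxP n; apply; exists i. Qed.

Let A_cvg : A n @[n --> \oo] --> D.
Proof. by have /fine_cvgP[] := a_sum. Qed.

Let A_ge0 n : 0 <= A n.
Proof. by apply: fine_ge0; apply: nneseries_ge0 => i _ _; rewrite lee_fin. Qed.

Let partial_le_A n N : (\sum_(i <oo) (a i n)%:E)%E \is a fin_num ->
  \sum_(i < N) a i n <= A n.
Proof.
move=> fA; rewrite -lee_fin /A fineK// -sumEFin.
rewrite -(big_mkord xpredT (fun i => (a i n)%:E)).
by apply: nneseries_lim_ge => i _ _; rewrite lee_fin.
Qed.

Let moment c : 0 < c -> c < kappa -> exists M : R,
  (\int[P]_w (stretched_weight r c (Xs 0%N w))%:E <= M%:E)%E.
Proof.
move=> c0 ck.
pose delta := (1 - c / kappa) / 2.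
have ck1 : c / kappa < 1 by rewrite ltr_pdivrMr// mul1r.
have delta0 : 0 < delta by rewrite /delta; lra.
apply: (@stretched_moment_bounded _ _ _ _ _ r c (kappa * (1 - delta))) => //.
  have e : c = kappa * (c / kappa) by field; rewrite gt_eqF.
  by rewrite {1}e ltr_pM2l// /delta; lra.
by have := X_tail delta0; apply: filterS => t /andP[].
Qed.

(** [weighted_sum_upper_bound] with rate [c = kappa (1 - delta)]. There
    [theta M alpha] is a multiple of [alpha ^ (1 - r)], so it vanishes and the
    linear factor of the exponent eventually exceeds [y (1 - delta)]. *)
Lemma upper_tail x delta : D * m < x -> 0 < delta -> delta < 1 ->
  exists2 C, 0 < C & \forall n \near \oo,
    (p x n <= (C * expR (- (kappa * (x - D * m) `^ r * (1 - delta) ^+ 2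
                            / amax n `^ r)))%:E)%E.
Proof.
move=> xDm delta0 delta1.
pose y := x - D * m.
have y0 : 0 < y by rewrite subr_gt0.
pose c := kappa * (1 - delta).
have c0 : 0 < c by rewrite mulr_gt0// subr_gt0.
have ck : c < kappa by rewrite /c gtr_pMr//; lra.
have [M XM] := moment c0 ck.
have M0 : 0 <= M.
  rewrite -lee_fin; apply: le_trans XM; apply: integral_ge0 => w _.
  by rewrite lee_fin stretched_weight_ge0.
have D0 : 0 <= D + 1 by rewrite addr_ge0.
exists ((D + 1) * M / y + 1).
  by rewrite ltr_wpDl// divr_ge0 ?mulr_ge0// ltW.
pose k := c * y `^ (r - 1) * M.
have k_cvg : x - m * A n - k * amax n `^ (1 - r) * A n @[n --> \oo]
    --> x - m * D - k * 0 * D.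
  apply: cvgB; first by apply: cvgB; [exact: cvg_cst|exact: cvgMr].
  apply: cvgM => //; apply: cvgMr; apply: cvg_powR0 => //.
  by rewrite subr_gt0.
have near_gt : \forall n \near \oo,
    y * (1 - delta) <= x - m * A n - k * amax n `^ (1 - r) * A n.
  move/cvgrPdist_le : k_cvg => /(_ (y * delta)); rewrite mulr_gt0// => /(_ isT).
  apply: filterS => n; rewrite ler_norml => /andP[_ h].
  by move: h; rewrite /y; lra.
have A_le : \forall n \near \oo, A n <= D + 1.
  move/cvgrPdist_le : A_cvg => /(_ _ ltr01); apply: filterS => n.
  by rewrite ler_norml => /andP[h _]; lra.
have fin : \forall n \near \oo, (\sum_(i <oo) (a i n)%:E)%E \is a fin_num.
  by have /fine_cvgP[] := a_sum.
near=> n.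
have fA : (\sum_(i <oo) (a i n)%:E)%E \is a fin_num by near: n.
have AD : A n <= D + 1 by near: n.
have gt_y : y * (1 - delta) <= x - m * A n - k * amax n `^ (1 - r) * A n.
  by near: n.
have ar0 : 0 < amax n `^ r by exact: powR_gt0.
set E := expR _.
apply: probability_series_le => // N.
have aP i : 0 <= a i n <= amax n by rewrite a_ge0 a_le.
apply: (le_trans (weighted_sum_upper_bound Xs_ge0 Xs_indep Xs_law r_gt0 r_lt1 c0
  X_mean XM x (amax_gt0 n) y0 aP (partial_le_A N fA))).
rewrite lee_fin [leRHS]mulrDl [1 * E]mul1r.
have yr0 : 0 <= y `^ r by exact: powR_ge0.
have d01 : (1 - delta) ^+ 2 <= 1 - delta by nra.
pose Z := kappa * y `^ r / amax n `^ r.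
have Z0 : 0 <= Z by rewrite /Z !mulr_ge0 ?invr_ge0 ?powR_ge0// ltW.
apply: lerD.
  apply: ler_pM.
  - by rewrite mulr_ge0 ?invr_ge0 ?(ltW y0)// mulr_ge0.
  - exact: expR_ge0.
  - by rewrite ler_wpM2r ?invr_ge0 ?(ltW y0)// ler_wpM2r.
  - rewrite ler_expR lerN2 powR_div ?(ltW y0)//.
    rewrite -/y /c [leLHS](_ : _ = Z * (1 - delta) ^+ 2); last by rewrite /Z; ring.
    rewrite [leRHS](_ : _ = Z * (1 - delta)); last by rewrite /Z; ring.
    exact: ler_wpM2l.
rewrite ler_expR lerN2.
set theta := c * _.
have theta0 : 0 <= theta by rewrite mulr_ge0 ?divr_ge0 ?powR_ge0 ?(ltW c0).
apply: (@le_trans _ _ (theta * (y * (1 - delta)))).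
  rewrite -/y -(mulr_powRB1 (ltW y0) r_gt0) /theta /c.
  by rewrite le_eqVlt; apply/predU1P; left; ring.
rewrite ler_wpM2l//; move: gt_y; rewrite /k.
rewrite (@powRB _ (amax n) 1 r) ?powRr1 ?(ltW (amax_gt0 n))//; last first.
  by apply/implyP => _; rewrite gt_eqF.
move=> /le_trans; apply; rewrite le_eqVlt; apply/predU1P; left.
by rewrite /theta; ring.
Unshelve. all: by end_near. Qed.

(** [weighted_sum_lower_bound] with [c' = D m - delta y]: the jump has to
    reach [x - c' = y (1 + delta)]. Together with the factor [1 + delta] of the
    tail estimate it costs [kappa (1 + delta) ^ (1 + r) (y / alpha) ^ r], where
    the exponent [1 + r] is less than [2]. *)
Lemma lower_tail x delta : D * m < x -> 0 < delta -> delta < 1 ->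
  exists2 C, 0 < C & \forall n \near \oo,
    ((C * expR (- (kappa * (x - D * m) `^ r * (1 + delta) ^+ 2
                            / amax n `^ r)))%:E <= p x n)%E.
Proof.
move=> xDm delta0 delta1.
pose y := x - D * m.
have y0 : 0 < y by rewrite subr_gt0.
(* Any rate below [kappa] gives the finite moment that the Laplace bound uses. *)
pose c := kappa / 2.
have c0 : 0 < c by rewrite divr_gt0.
have ck : c < kappa by rewrite /c; have := kappa_gt0; lra.
have [M XM] := moment c0 ck.
pose eps := delta * y.
have eps0 : 0 < eps by exact: mulr_gt0.
(* The linear factor tends to [eps], so it is eventually at least [eps / 2]. *)
pose theta := 2 / eps.
have theta0 : 0 < theta by exact: divr_gt0.
pose c' := D * m - eps.
exists (2^-1) => //.
have A_near : \forall n \near \oo,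
    eps / 2 <= m * (A n - 2 * amax n) - theta * M * amax n * A n - c'.
  have cv : m * (A n - 2 * amax n) - theta * M * amax n * A n - c' @[n --> \oo]
    --> m * (D - 2 * 0) - theta * M * 0 * D - c'.
    apply: cvgB; last exact: cvg_cst.
    apply: cvgB; first by apply: cvgMr; apply: cvgB => //; exact: cvgMr.
    by apply: cvgM => //; exact: cvgMr.
  move/cvgrPdist_le : cv => /(_ (eps / 2)); rewrite divr_gt0// => /(_ isT).
  apply: filterS => n; rewrite ler_norml => /andP[_ h].
  by move: h; rewrite /c'; lra.
have fin : \forall n \near \oo, (\sum_(i <oo) (a i n)%:E)%E \is a fin_num.
  by have /fine_cvgP[] := a_sum.
have tail_near : \forall n \near \oo,
    ((expR (- (kappa * (1 + delta) * (y * (1 + delta) / amax n) `^ r)))%:E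
      <= P [set w | (y * (1 + delta) / amax n < Xs 0%N w)%R])%E.
  have [K [_ HK]] := X_tail delta0.
  have K1 : 0 < y * (1 + delta) / (`|K| + 1).
    by apply: divr_gt0; [rewrite mulr_gt0// addr_gt0|rewrite ltr_wpDl].
  move/cvgrPdist_lt : amax_to0 => /(_ _ K1); apply: filterS => n.
  rewrite sub0r normrN gtr0_norm// ltr_pdivlMr ?ltr_wpDl// => h.
  have /HK/andP[] // : K < y * (1 + delta) / amax n.
  rewrite ltr_pdivlMr//; apply: le_lt_trans h.
  rewrite mulrC ler_wpM2l ?(ltW (amax_gt0 n))//.
  by have := ler_norm K; lra.
near=> n.
have fA : (\sum_(i <oo) (a i n)%:E)%E \is a fin_num by near: n.
have An : eps / 2 <= m * (A n - 2 * amax n) - theta * M * amax n * A n - c'.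
  by near: n.
have tn : ((expR (- (kappa * (1 + delta) * (y * (1 + delta) / amax n) `^ r)))%:E
      <= P [set w | (y * (1 + delta) / amax n < Xs 0%N w)%R])%E by near: n.
have [[i0 _ ai0] _] := amaxP n.
have [N [i0N AN]] : exists N, (i0 < N)%N /\ A n - amax n <= \sum_(i < N) a i n.
  have cv : (\sum_(0 <= i < k) (a i n)%:E)%E @[k --> \oo] --> (A n)%:E.
    by rewrite /A fineK//; apply: is_cvg_nneseries => i _ _; rewrite lee_fin.
  have /fine_cvgP[_ /cvgrPdist_le /(_ _ (amax_gt0 n)) cvA] := cv.
  have [N [i0N]] := filter_ex (filterI (nbhs_infty_gt i0) cvA).
  rewrite /= sumEFin big_mkord ler_norml => /andP[_ h]; exists N; split => //.
  by move: h; rewrite /=; lra.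
have aP i : 0 <= a i n <= amax n by rewrite a_ge0 a_le.
have AA : A n - amax n <= \sum_(i < N) a i n <= A n by rewrite AN partial_le_A.
have big : 1 <= theta * (m * (A n - 2 * amax n) - theta * M * amax n * A n - c').
  apply: (@le_trans _ _ (theta * (eps / 2))); last by rewrite ler_wpM2l// ltW.
  by rewrite /theta mulrA mulfVK ?gt_eqF// divff.
have := weighted_sum_lower_bound Xs_ge0 Xs_indep Xs_law c0 X_mean XM
  x (i0 := Ordinal i0N) (amax_gt0 n) (ltW theta0) aP ai0 AA big.
rewrite (_ : x - c' = y * (1 + delta)); last by rewrite /c' /eps /y; ring.
move=> /(le_trans tn) h.
apply: (@le_trans _ _
  (P [set w | (x < \sum_(i < N) a i n * Xs i w)%R])); last first.
  exact: le_probability_series.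
rewrite -(@lee_pmul2l _ 2%:E)// -EFinM mulrA divff// mul1r.
apply: le_trans h; rewrite lee_fin ler_expR lerN2.
have d1 : 0 <= 1 + delta by rewrite addr_ge0// ltW.
rewrite powR_div ?mulr_ge0 ?(ltW y0)// powRM ?(ltW y0)//.
pose Z := kappa * y `^ r / amax n `^ r * (1 + delta).
have Z0 : 0 <= Z.
  by rewrite /Z !mulr_ge0 ?invr_ge0 ?powR_ge0// ltW.
rewrite -/y [leLHS](_ : _ = Z * (1 + delta) `^ r); last by rewrite /Z; ring.
rewrite [leRHS](_ : _ = Z * (1 + delta)); last by rewrite /Z; ring.
by apply: ler_wpM2l => //; apply: ler1_powR; [rewrite lerDl ltW|exact: ltW].
Unshelve. all: by end_near. Qed.

End tail_of_series.

Theorem theorem2p1 (d : measure_display) (T : measurableType d) (R : realType)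
    (P : probability T R) (r kappa : R) (X : {RV P >-> R})
    (Xs : nat -> {RV P >-> R}) (a : nat -> nat -> R) (amax : nat -> R) (D : R)
    (r_gt0 : 0 < r) (r_lt1 : r < 1) (kappa_gt0 : 0 < kappa)
    (Xs_ge0 : forall i w, 0 <= Xs i w)
    (Xs_indep : mutually_independent Xs)
    (Xs_law : forall i, same_law (Xs i) X)
    (X_tail : (lne (P [set w | (t < X w)%R]) / (- (kappa * t `^ r))%:E)%E
                @[t --> +oo] --> 1%E)
    (a_ge0 : forall i n, 0 <= a i n)
    (D_ge0 : 0 <= D)
    (a_sum : (\sum_(i <oo) (a i n)%:E)%E @[n --> \oo] --> D%:E)
    (amaxP : forall n, is_maximum (range (a^~ n)) (amax n))
    (amax_gt0 : forall n, 0 < amax n)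
    (amax_to0 : amax n @[n --> \oo] --> 0)
    (x : R) (x_gt : (D%:E * 'E_P[X] < x%:E)%E) :
  ((amax n `^ r)%:E *
     lne (P [set w | x%:E < \sum_(i <oo) (a i n * Xs i w)%:E]))%E
    @[n --> \oo]
  --> (- (kappa%:E * (x%:E - D%:E * 'E_P[X]) `^ r))%E.
Proof.
have law0 i : same_law (Xs i) (Xs 0%N).
  by move=> B mB; rewrite Xs_law// -(Xs_law 0%N).
have tail delta : 0 < delta -> \forall t \near +oo,
    ((expR (- (kappa * (1 + delta) * t `^ r)))%:E <= P [set w | (t < Xs 0%N w)%R]
      <= (expR (- (kappa * (1 - delta) * t `^ r)))%:E)%E.
  move=> delta0.
  have := log_tail_bounds kappa_gt0 delta0
    (fun t => measure_ge0 P [set w | (t < X w)%R]) X_tail.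
  by apply: filterS => t; rewrite (same_law_gt t (Xs_law 0%N)).
have [M XM] : exists M : R,
  (\int[P]_w (stretched_weight r (kappa / 4) (Xs 0%N w))%:E <= M%:E)%E.
  apply: (@stretched_moment_bounded _ _ _ _ _ r (kappa / 4)
    (kappa * (1 - 1 / 2))) => //.
  - exact: divr_gt0.
  - by have := kappa_gt0; lra.
  - have d0 : (0 : R) < 1 / 2 by exact: divr_gt0.
    by have := tail _ d0; apply: filterS => t /andP[].
have fE : ('E_P[X])%E \is a fin_num.
  rewrite -(same_law_expectation (Xs_law 0%N)).
  apply: (@stretched_moment_expectation_fin_num _ _ _ _ _ r (kappa / 4) M) => //.
  exact: divr_gt0.
pose m := fine ('E_P[X])%E.
have Xm : (\int[P]_w (Xs 0%N w)%:E = m%:E)%E.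
  by rewrite -expectation_def (same_law_expectation (Xs_law 0%N)) /m fineK.
move: x_gt; rewrite -(fineK fE) -/m -EFinM lte_fin => x_gt'.
rewrite -EFinB poweR_EFin -EFinM -EFinN.
apply: cvg_log_sandwich => //.
- by rewrite mulr_ge0 ?powR_ge0// ltW.
- move=> delta d0 d1; exact: (upper_tail (m := m) (D := D)).
- move=> delta d0 d1; exact: (lower_tail (m := m) (D := D)).
Qed.
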